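(* Let $\mathcal S$ be a separable metric space equipped with a reference measure $\mathcal L$ (integration written $ds$), let $t_{\mathfrak s}:\mathcal S\times\mathcal S\to\mathbb R^{\ge0}$ be a transition density ($\int_{\mathcal S}t_{\mathfrak s}(\bar s|s)\,d\bar s=1$ for all $s$) of a discrete-time Markov process $s(0),s(1),\dots$ on $\mathcal S$, whose initial state has a bounded density $\pi_0$, and let $\pi_t$ be the density of $s(t)$, i.e. $\pi_{t+1}(\bar s)=\int_{\mathcal S}t_{\mathfrak s}(\bar s|s)\pi_t(s)\,ds$. Assume that $M_{\mathfrak f}:=\sup_{\bar s\in\mathcal S}\int_{\mathcal S}t_{\mathfrak s}(\bar s|s)\,ds$ is finite and $M_{\mathfrak f}<1$. If the state space $\mathcal S$ is unbounded, then the sequence $\{\pi_t\}_{t\ge0}$ converges to zero uniformly exponentially (there exist $C<\infty$ and $r\in[0,1)$ with $\sup_{s\in\mathcal S}\pi_t(s)\le Cr^t$ for all $t$), and for every compact safe set $\mathcal A\subset\mathcal S$ both the probabilities $\mathbb P\{s(t)\in\mathcal A\}$ and the safety probabilities $\mathbb P\{s(u)\in\mathcal A\text{ for all }u\in\{0,1,\dots,t\}\}$ converge to zero exponentially as $t\to\infty$.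
   Context: $\mathbb P$ denotes the law of the Markov process started with $s(0)$ distributed according to $\pi_0$.
   Formalization: The reference measure is additionally assumed sigma-finite and finite on compact sets (as for any locally finite Borel measure); without finiteness on compact sets the claim about the probabilities of staying in a compact safe set is false. *)

(* Defs.v *)
From HB Require Import structures.
From mathcomp Require Import all_boot all_order all_algebra.
From mathcomp Require Import all_classical all_reals all_analysis.
Import Order.TTheory GRing.Theory Num.Theory.
Import numFieldNormedType.Exports.

Set Implicit Arguments.
Unset Strict Implicit.
Unset Printing Implicit Defensive.

Local Open Scope classical_set_scope.
Local Open Scope ring_scope.

(* A metric space that also carries a sigma-algebra. The two structures are
   independent of each other: [borel] below says that the sigma-algebra is the
   Borel one. *)
#[short(type="measurableMetricType")]
HB.structure Definition MeasurableMetric (K : numDomainType) d :=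
  { T of Metric K T & Measurable d T }.

Section metric_spaces.
Context {R : realType} {d : measure_display}.
Variable S : measurableMetricType R d.

Definition borel : Prop := @measurable d S = <<s (@open S) >>.

Definition separable : Prop :=
  exists D : set S, countable D /\ dense D.

Definition unbounded : Prop :=
  ~ exists M : R, forall x y : S, mdist x y <= M.

(* The properties of Lebesgue measure on R^n that a reference measure is to
   have: sigma-finiteness is what Tonelli's theorem needs, and without finiteness
   on compact sets a chain with Mf < 1 may stay in a compact set forever. Both
   hold when L is locally finite and S is separable. *)
Definition reference_measure (L : {measure set S -> \bar R}) : Prop :=
  sigma_finite [set: S] L /\
  (forall K : set S, compact K -> (L K < +oo)%E).

End metric_spaces.

Section transition_densities.
Context {R : realType} {d : measure_display} {S : measurableType d}.
Variable L : {measure set S -> \bar R}.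

(* [tr y x] stands for t(y | x): the density at y of the next state, given
   that the current state is x. *)
Definition transition_density (tr : S -> S -> R) : Prop :=
  [/\ forall y x, 0 <= tr y x,
      measurable_fun [set: S * S] (fun p : S * S => tr p.1 p.2) &
      forall x, (\int[L]_y (tr y x)%:E = 1)%E].

(* The integral is over the conditioning variable. *)
Definition Mf (tr : S -> S -> R) : \bar R :=
  ereal_sup (range (fun y => \int[L]_x (tr y x)%:E)%E).

Fixpoint state_density (tr : S -> S -> R) (pi0 : S -> R) (t : nat) :
    S -> \bar R :=
  if t is t'.+1 then
    fun y => (\int[L]_x ((tr y x)%:E * state_density tr pi0 t' x))%E
  else fun y => (pi0 y)%:E.

End transition_densities.

Section markov_processes.
Context {R : realType} {d d' : measure_display}.
Context {S : measurableType d} {Omega : measurableType d'}.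
Variables (L : {measure set S -> \bar R}) (P : probability Omega R).

Definition has_density (X : {RV P >-> S}) (f : S -> R) : Prop :=
  [/\ forall x, 0 <= f x,
      measurable_fun [set: S] f &
      forall A, measurable A ->
        P (X @^-1` A) = (\int[L]_(x in A) (f x)%:E)%E].

(* The sigma-algebra generated by X 0, ..., X t. *)
Definition natural_filtration (X : nat -> {RV P >-> S}) (t : nat) :
    set (set Omega) :=
  <<s \bigcup_(u in [set u | (u <= t)%N])
        preimage_set_system [set: Omega] (X u) measurable >>.

(* P(X (t+1) \in A | X 0, ..., X t) = \int_A tr(y | X t) dy almost surely,
   written through the defining property of conditional probability. *)
Definition markov_process (tr : S -> S -> R) (X : nat -> {RV P >-> S}) : Prop :=
  forall (t : nat) (B : set Omega) (A : set S),
    natural_filtration X t B -> measurable A ->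
    P (B `&` X t.+1 @^-1` A) =
      (\int[P]_(w in B) \int[L]_(y in A) (tr y (X t w))%:E)%E.

End markov_processes.

(* Meant for nonnegative sequences. *)
Definition cvg_exponentially {R : realType} (u : nat -> \bar R) : Prop :=
  exists C r : R, [/\ 0 <= r, r < 1 &
    forall t : nat, (u t <= (C * r ^+ t)%:E)%E].

(* Main.v *)
Require Import Defs.
From HB Require Import structures.
From mathcomp Require Import all_boot all_order all_algebra.
From mathcomp Require Import all_classical all_reals all_analysis.
From mathcomp Require Import measurable_realfun.
Import Order.TTheory GRing.Theory Num.Theory.
Import numFieldNormedType.Exports.
Local Open Scope classical_set_scope.
Local Open Scope ring_scope.

(* Integrating over the conditioning variable contracts by the factor Mf: a
   density bounded by c is mapped to one bounded by Mf * c. Hence the density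
   of s(t) is at most M * Mf ^ t. By Tonelli's theorem the same contraction acts
   directly on the laws, without identifying their densities with pi_t: if the
   law of s(t) is at most c * L, then that of s(t+1) is at most Mf * c * L; and
   L is finite on compact sets. *)

(** A compact set is closed because a metric space is Hausdorff, so its complement is an open
    generator of the Borel sigma-algebra. *)
Lemma compact_measurable (R : realType) (d : measure_display)
    (S : measurableMetricType R d) (A : set S) :
  borel S -> compact A -> measurable A.
Proof.
move=> bS cA; have clA : closed A.
  by apply: compact_closed => //; exact: metric_hausdorff.
rewrite -(setCK A); apply: measurableC; rewrite bS.
by apply: sub_sigma_algebra; exact: closed_openC.
Qed.

Section densities.
Local Open Scope ereal_scope.
Context {R : realType} {d : measure_display} {S : measurableType d}.
Variable L : {sigma_finite_measure set S -> \bar R}.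
Variables (tr : S -> S -> R) (pi0 : S -> R).
Hypothesis tr_ge0 : forall y x, (0 <= tr y x)%R.
Hypothesis measurable_tr :
  measurable_fun [set: S * S] (fun p : S * S => tr p.1 p.2).

Let measurable_trE :
  measurable_fun [set: S * S] (EFin \o (fun p : S * S => tr p.1 p.2)).
Proof. exact/measurable_EFinP. Qed.

Lemma measurable_tr_prev y : measurable_fun [set: S] (EFin \o tr y).
Proof. exact: (measurableT_comp measurable_trE (pair1_measurable y)). Qed.

Lemma state_density_ge0 t y :
  (forall x, 0 <= pi0 x)%R -> 0 <= state_density L tr pi0 t y.
Proof.
move=> pi0_ge0; elim: t y => [|t IH] y /=; first by rewrite lee_fin.
by apply: integral_ge0 => x _; rewrite mule_ge0 ?lee_fin.
Qed.

Lemma measurable_state_density t :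
  (forall x, 0 <= pi0 x)%R -> measurable_fun [set: S] pi0 ->
  measurable_fun [set: S] (state_density L tr pi0 t).
Proof.
move=> pi0_ge0 mpi0; elim: t => [|t IH] /=; first exact/measurable_EFinP.
(* The integrand is nonnegative and jointly measurable in [(y, x)], so Tonelli's theorem makes its
   partial integral over [x] measurable in [y]. *)
apply: (measurable_fun_fubini_tonelli_F (m2 := L)
  (fun p : S * S => (tr p.1 p.2)%:E * state_density L tr pi0 t p.2)).
- by apply: emeasurable_funM => //; exact: measurableT_comp IH _.
- by move=> p; rewrite mule_ge0 ?lee_fin// state_density_ge0.
Qed.

Variable r : R.
Hypothesis integral_tr_le : forall y, \int[L]_x (tr y x)%:E <= r%:E.

Lemma state_density_le (M : R) t y :
  (forall x, 0 <= pi0 x)%R -> measurable_fun [set: S] pi0 ->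
  (0 <= M)%R -> (forall x, pi0 x <= M)%R -> (0 <= r)%R ->
  state_density L tr pi0 t y <= (M * r ^+ t)%:E.
Proof.
move=> pi0_ge0 mpi0 M0 pi0M r0; elim: t y => [|t IH] y /=.
  by rewrite expr0 mulr1 lee_fin.
have c0 : (0 <= M * r ^+ t)%R by rewrite mulr_ge0 ?exprn_ge0.
apply: (@le_trans _ _ (\int[L]_x ((M * r ^+ t)%:E * (tr y x)%:E))).
  apply: ge0_le_integral => //.
  - by move=> x _; rewrite mule_ge0 ?lee_fin// state_density_ge0.
  - apply: emeasurable_funM; first exact: measurable_tr_prev.
    exact: measurable_state_density.
  - by apply: measurable_funeM; exact: measurable_tr_prev.
  - by move=> x _; rewrite muleC lee_wpmul2r ?lee_fin.
rewrite ge0_integralZl//.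
- by rewrite exprSr mulrA [leRHS]EFinM lee_wpmul2l ?lee_fin.
- exact: measurable_tr_prev.
- by move=> x _; rewrite lee_fin.
Qed.

(** The indicator turns an integral over [A] into one over the whole space, the form in which
    Tonelli's theorem is applied. *)
Let tr_in (A : set S) (p : S * S) : \bar R :=
  (tr p.1 p.2)%:E * (\1_A p.1)%:E.

Let tr_in_ge0 A p : 0 <= tr_in A p.
Proof. by rewrite mule_ge0 ?lee_fin. Qed.

Let measurable_tr_in A : measurable A -> measurable_fun setT (tr_in A).
Proof.
move=> mA; apply: emeasurable_funM => //.
by apply/measurable_EFinP; apply: measurableT_comp.
Qed.

Let integral_tr_in A x : measurable A ->
  \int[L]_(y in A) (tr y x)%:E = \int[L]_y tr_in A (y, x).
Proof.
move=> mA; rewrite integral_mkcond epatch_indic; exact: eq_integral.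
Qed.

Lemma measurable_transition_prob (A : set S) : measurable A ->
  measurable_fun [set: S] (fun x => \int[L]_(y in A) (tr y x)%:E).
Proof.
move=> mA; under eq_fun do rewrite integral_tr_in//.
apply: (measurable_fun_fubini_tonelli_G (tr_in A)) => //.
exact: measurable_tr_in.
Qed.

(** After exchanging the integrals, the inner one runs over the conditioning variable and is at most
    [r]; what remains is [r] times the integral of the indicator of [A]. *)
Lemma integral_transition_prob_le (A : set S) : (0 <= r)%R -> measurable A ->
  \int[L]_x \int[L]_(y in A) (tr y x)%:E <= r%:E * L A.
Proof.
move=> r0 mA; under eq_integral do rewrite integral_tr_in//.
rewrite -(fubini_tonelli (tr_in A))//; last exact: measurable_tr_in.
rewrite -[X in L X]setIT -integral_indic// -ge0_integralZl//; last first.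
  exact/measurable_EFinP.
apply: ge0_le_integral => //.
- by move=> y _; apply: integral_ge0 => x _; exact: tr_in_ge0.
- apply: (measurable_fun_fubini_tonelli_F (tr_in A)) => //.
  exact: measurable_tr_in.
- by apply: measurable_funeM; exact/measurable_EFinP.
- move=> y _; rewrite /tr_in/= ge0_integralZr//.
  + by rewrite lee_wpmul2r ?lee_fin.
  + exact: measurable_tr_prev.
  + by move=> x _; rewrite lee_fin.
Qed.

Lemma markov_law_le (d' : measure_display) (Omega : measurableType d')
    (P : probability Omega R) (X : nat -> {RV P >-> S}) (M : R) t A :
  markov_process L tr X -> has_density L (X 0%N) pi0 ->
  (0 <= M)%R -> (forall x, pi0 x <= M)%R -> (0 <= r)%R -> measurable A ->
  P (X t @^-1` A) <= (M * r ^+ t)%:E * L A.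
Proof.
move=> X_markov [pi0_ge0 mpi0 X0] M0 pi0M r0.
(* [A] stays general: the step needs the bound at time [t] on every measurable set, as an inequality
   between measures. *)
elim: t A => [|t IH] A mA.
  rewrite X0// expr0 mulr1 -integral_cst//.
  apply: ge0_le_integral => //.
  - by move=> x _; rewrite lee_fin.
  - by apply: measurable_funTS; exact/measurable_EFinP.
  - by move=> x _; rewrite lee_fin.
have c0 : (0 <= M * r ^+ t)%R by rewrite mulr_ge0 ?exprn_ge0.
(* Conditioning on the sure event reduces the Markov property to the one-step formula for the law of
   [X t.+1]. *)
have FT : natural_filtration X t [set: Omega].
  by rewrite -setC0 -setTD; apply: sigma_algebraCD; exact: sigma_algebra0.
have mg := measurable_transition_prob A mA.
have g0 x : 0 <= \int[L]_(y in A) (tr y x)%:E.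
  by apply: integral_ge0 => y _; rewrite lee_fin.
rewrite -[X in P X]setTI (X_markov _ _ _ FT mA).
have -> : \int[P]_w \int[L]_(y in A) (tr y (X t w))%:E =
    \int[pushforward P (X t)]_x \int[L]_(y in A) (tr y x)%:E.
  by rewrite ge0_integral_pushforward.
(* By [IH] the law of [X t] lies below the measure [M * r ^+ t] times [L], so integrals of
   nonnegative functions compare in the same way. *)
apply: (@le_trans _ _ (\int[mscale (NngNum c0) L]_x
    \int[L]_(y in A) (tr y x)%:E)).
  by apply: ge0_le_measure_integral => // B mB; exact: IH.
rewrite ge0_integral_mscale//= exprSr mulrA [X in X * L A]EFinM -muleA.
by rewrite lee_wpmul2l ?lee_fin// integral_transition_prob_le.
Qed.

End densities.

Theorem theorem7p3 (R : realType) (d d' : measure_display)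
  (S : measurableMetricType R d) (L : {measure set S -> \bar R})
  (tr : S -> S -> R) (pi0 : S -> R)
  (Omega : measurableType d') (P : probability Omega R)
  (X : nat -> {RV P >-> S})
  (S_borel : borel S) (S_separable : separable S)
  (L_ref : reference_measure L)
  (tr_density : transition_density L tr)
  (X_markov : markov_process L tr X)
  (X0_density : has_density L (X 0%N) pi0)
  (pi0_bounded : exists M : R, forall x : S, pi0 x <= M)
  (Mf_finite : (Mf L tr < +oo)%E) (Mf_lt1 : (Mf L tr < 1)%E)
  (S_unbounded : unbounded S) :
  cvg_exponentially (fun t => ereal_sup (range (state_density L tr pi0 t))) /\
  forall A : set S, compact A ->
    cvg_exponentially (fun t => P [set w | A (X t w)]) /\
    cvg_exponentially
      (fun t => P [set w | forall u : nat, (u <= t)%N -> A (X u w)]).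
Proof.
have [L_sigma L_compact] := L_ref.
have [tr0 mtr _] := tr_density.
have [pi0_ge0 mpi0 _] := X0_density.
have [M0 pi0M0] := pi0_bounded.
(* The maximum with 0 gives a nonnegative bound without choosing a point of [S]. *)
pose M : R := Num.max 0 M0.
have M_ge0 : 0 <= M by rewrite le_max lexx.
have pi0M x : pi0 x <= M by rewrite le_max pi0M0 orbT.
(* A supremum over an empty range would be [-oo]; the maximum with 0 excludes this, and with [Mf]
   finite [fine] loses nothing. *)
pose r := fine (maxe 0%E (Mf L tr)).
have rE : r%:E = maxe 0%E (Mf L tr).
  rewrite fineK// ge0_fin_numE ?le_max ?lexx// gt_max Mf_finite andbT.
  exact: ltry.
have r_ge0 : 0 <= r by rewrite -lee_fin rE le_max lexx.
have r_lt1 : r < 1 by rewrite -lte_fin rE gt_max Mf_lt1 lte01.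
have trr y : (\int[L]_x (tr y x)%:E <= r%:E)%E.
  by rewrite rE le_max; apply/orP; right; apply: ereal_sup_ubound; exists y.
have L_sfinite : sfinite_measure L by exact: sfinite_measure_sigma_finite.
pose L' : {sigma_finite_measure set S -> \bar R} := HB.pack (Measure.sort L)
  (isSFinite.Build _ _ _ (Measure.sort L) L_sfinite)
  (isSigmaFinite.Build _ _ _ (Measure.sort L) L_sigma).
split.
  exists M, r; split=> // t; apply: ge_ereal_sup => _ [y _ <-].
  exact: (state_density_le L' tr pi0).
move=> A cA; have mA := compact_measurable _ _ _ _ S_borel cA.
(* Compactness enters here: [L A] is finite, so [M * fine (L A)] can serve as the constant for both
   probabilities. *)
have LA : (fine (L A))%:E = L A.
  by rewrite fineK// ge0_fin_numE// L_compact.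
have PX t : (P (X t @^-1` A) <= (M * fine (L A) * r ^+ t)%:E)%E.
  rewrite mulrAC EFinM LA.
  exact: (markov_law_le L' tr pi0).
have mX t : measurable (X t @^-1` A).
  by rewrite -[X in measurable X]setTI; exact: measurable_funP.
split; exists (M * fine (L A)), r; split=> // t.
(* Staying in [A] up to time [t] implies being in [A] at time [t]: take [u = t]. *)
apply: le_trans (PX t); apply: le_measure; rewrite ?inE//.
  rewrite (_ : mkset _ = \bigcap_(u in [set u | (u <= t)%N]) (X u @^-1` A))//.
  by apply: bigcap_measurableType => u _; exact: mX.
by move=> w; apply.
Qed.
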